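(* Let $\mathcal{A}$ be an algebra and $\mathcal{I}$ be an ideal in $\mathcal{A}$. Then $\mathcal{A}$ is faithful if and only if the convolution product algebra $\mathcal{A} \times_c \mathcal{I}$ is faithful.
   Context: Algebras are associative algebras over $\mathbb{C}$ (not assumed unital or commutative); ideals are two-sided. An algebra $\mathcal{A}$ is faithful if the only $a \in \mathcal{A}$ with $ab = 0$ for all $b \in \mathcal{A}$ is $a = 0$. For an algebra $\mathcal{A}$ and an ideal $\mathcal{I}$ of $\mathcal{A}$, the convolution product algebra $\mathcal{A} \times_c \mathcal{I}$ is the vector space $\mathcal{A} \times \mathcal{I}$ with coordinatewise linear operations and the product $(a,x) \times_c (b,y) = (ab + xy, ay + xb)$. *)

(* Defs.v *)
From HB Require Import structures.
From mathcomp Require Import all_boot all_algebra.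
From mathcomp Require Import reals complex.

Set Implicit Arguments.
Unset Strict Implicit.
Unset Printing Implicit Defensive.

Import GRing.Theory.

Local Open Scope ring_scope.

(* MathComp's algType is unital; this is its analogue with a unit not required. *)
HB.mixin Record Lmodule_isNuAlgebra (K : comNzRingType) A
    of GRing.Lmodule K A := {
  numul : A -> A -> A;
  numulA : associative numul;
  numulDl : left_distributive numul +%R;
  numulDr : right_distributive numul +%R;
  scale_numull : forall (k : K) (a b : A), k *: numul a b = numul (k *: a) b;
  scale_numulr : forall (k : K) (a b : A), k *: numul a b = numul a (k *: b)
}.

#[short(type="nuAlgType")]
HB.structure Definition NuAlgebra (K : comNzRingType) :=
  {A of Lmodule_isNuAlgebra K A & GRing.Lmodule K A}.

Notation "a ** b" := (numul a b) (at level 40, left associativity) : ring_scope.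

Definition nu_faithful (K : comNzRingType) (A : nuAlgType K) : Prop :=
  forall a : A, (forall b : A, a ** b = 0) -> a = 0.

(* Two-sided ideals, possibly improper (unlike MathComp's idealr).  Over C = R[i] with
   R : realType the axioms of boolp are available, so that boolean predicates
   describe arbitrary subsets. *)
HB.mixin Record isNuIdeal (K : comNzRingType) (A : nuAlgType K)
    (I : {pred A}) := {
  nuideal_mull : forall a x : A, x \in I -> a ** x \in I;
  nuideal_mulr : forall x b : A, x \in I -> x ** b \in I
}.

#[short(type="nuIdeal")]
HB.structure Definition NuIdeal (K : comNzRingType) (A : nuAlgType K) :=
  {I of isNuIdeal K A I & @GRing.SubmodClosed K A I}.

Section Convolution.

Variables (K : comNzRingType) (A : nuAlgType K) (I : nuIdeal A).

Definition nuideal_sub : Type := {x : A | x \in I}.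

HB.instance Definition _ := SubChoice.on nuideal_sub.
HB.instance Definition _ := [SubChoice_isSubLmodule of nuideal_sub by <:].

Definition ideal_lmul (a : A) (x : nuideal_sub) : nuideal_sub :=
  Sub (a ** val x) (nuideal_mull a _ (valP x)).

Definition ideal_rmul (x : nuideal_sub) (b : A) : nuideal_sub :=
  Sub (val x ** b) (nuideal_mulr _ b (valP x)).

Definition convprod : Type := (A * nuideal_sub)%type.

HB.instance Definition _ := GRing.Lmodule.on convprod.

Definition convmul (u v : convprod) : convprod :=
  (u.1 ** v.1 + val u.2 ** val v.2,
   ideal_lmul u.1 v.2 + ideal_rmul u.2 v.1).

Fact convmulA : associative convmul.
Proof.
move=> [a x] [b y] [c z]; congr pair; last apply: val_inj;
  by rewrite /= !numulDl !numulDr !numulA -!addrA; congr (_ + _);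
     rewrite addrA addrC.
Qed.

Fact convmulDl : left_distributive convmul +%R.
Proof.
move=> [a x] [b y] [c z]; congr pair; last apply: val_inj;
  by rewrite /= !numulDl addrACA.
Qed.

Fact convmulDr : right_distributive convmul +%R.
Proof.
move=> [a x] [b y] [c z]; congr pair; last apply: val_inj;
  by rewrite /= !numulDr addrACA.
Qed.

Fact scale_convmull (k : K) (u v : convprod) :
  k *: convmul u v = convmul (k *: u) v.
Proof.
case: u v => [a x] [b y]; congr pair; last apply: val_inj;
  by rewrite /= !scalerDr !scale_numull.
Qed.

Fact scale_convmulr (k : K) (u v : convprod) :
  k *: convmul u v = convmul u (k *: v).
Proof.
case: u v => [a x] [b y]; congr pair; last apply: val_inj;
  by rewrite /= !scalerDr !scale_numulr.
Qed.

HB.instance Definition _ := Lmodule_isNuAlgebra.Build K convprod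
  convmulA convmulDl convmulDr scale_convmull scale_convmulr.

End Convolution.

(* Main.v *)
Require Import Defs.
From mathcomp Require Import all_boot all_algebra.
From mathcomp Require Import reals complex.

Import GRing.Theory.

(** Multiplying $(a,x)$ by $(b,0)$ gives $(ab, xb)$, so an annihilator of the convolution product
    has both coordinates annihilating all of $A$, where faithfulness applies to each. Conversely, $a
    \mapsto (a,0)$ sends an annihilator of $A$ to one of the product, since $(a,0)(b,y) = (ab,
    ay)$. *)

Lemma numul0r (K : comNzRingType) (A : nuAlgType K) (b : A) : (0 ** b = 0)%R.
Proof. by apply: (addrI (0 ** b)%R); rewrite -numulDl !addr0. Qed.

Lemma numulr0 (K : comNzRingType) (A : nuAlgType K) (a : A) : (a ** 0 = 0)%R.
Proof. by apply: (addrI (a ** 0)%R); rewrite -numulDr !addr0. Qed.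

Lemma convprod_faithful (K : comNzRingType) (A : nuAlgType K) (I : nuIdeal A) :
  nu_faithful A <-> nu_faithful (convprod I).
Proof.
split=> [faithA [a x] ax0 | faithAI a a0].
  have ax_b0 b : (a ** b = 0 /\ val x ** b = 0)%R.
    by have [] := ax0 (b, 0%R); rewrite !numulr0 addr0 add0r.
  congr pair; first by apply: faithA => b; have [] := ax_b0 b.
  by apply/val_inj/faithA => b; have [] := ax_b0 b.
suff [] : ((a, 0) : convprod I)%R = 0%R by [].
(* In the second coordinate [a0] is used at [val y]: elements of the ideal are elements of [A], so
   [a] kills them too. *)
apply: faithAI => -[b y]; congr pair; last apply: val_inj;
  by rewrite /= a0 numul0r addr0.
Qed.

Theorem lemma2p8 (R : realType) (A : nuAlgType R[i]) (I : nuIdeal A) :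
  nu_faithful A <-> nu_faithful (convprod I).
Proof. exact: convprod_faithful. Qed.
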